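(* Let $n \geq 1$ and $m \geq 1$ be integers, let $p \geq 1$ be a real number, and let $a_i^{(k)} \in \mathbb{R}_+$ for $i \in \{1,2,\dots,n\}$ and $k \in \{1,2,\dots,m\}$. Then $$\left( \sum_{i=1}^{n} \left( \sum_{k=1}^{m} a_i^{(k)} \right)^p \right)^{1/p} \leq \sum_{k=1}^{m} \left( \sum_{i=1}^{n} \left(a_i^{(k)}\right)^p \right)^{1/p}.$$
   Context: $\mathbb{R}_+$ denotes the set of nonnegative real numbers. The superscript $(k)$ in $a_i^{(k)}$ is an index, not an exponent. *)

(* Defs.v *)
From mathcomp Require Import all_boot all_order all_algebra.
From mathcomp Require Import reals exp.
Set Implicit Arguments.
Unset Strict Implicit.
Unset Printing Implicit Defensive.

(* The real numbers are an arbitrary [R : realType]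
   and real powers are [powR], with notation [x `^ p]. On x >= 0 and p > 0
   this is the usual power; in particular 0 `^ p = 0. *)

(* Main.v *)
Require Import Defs.
From mathcomp Require Import all_boot all_order all_algebra.
From mathcomp Require Import reals exp.
From mathcomp Require Import classical_sets interval_inference convex hoelder.
From mathcomp Require Import ring.
Import Order.TTheory GRing.Theory Num.Theory.
Local Open Scope ring_scope.

(** Convexity of [x |-> x `^ p] at the weights [A / (A + B)] and [B / (A + B)],
    applied to the points [x i / A] and [y i / B], and summed over [i] with [A]
    and [B] the l^p norms of [x] and [y], gives the triangle inequality for two
    vectors; the general case is an induction on the number of vectors. *)

Lemma powR_addr_le {R : realType} {p A B x y : R} : 1 <= p -> 0 < A -> 0 < B ->
  0 <= x -> 0 <= y ->
  (x + y) `^ p <= (A + B) `^ p *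
    (A / (A + B) * (x `^ p / A `^ p) + B / (A + B) * (y `^ p / B `^ p)).
Proof.
move=> p1 A0 B0 x0 y0.
have AB0 : 0 < A + B by rewrite addr_gt0.
have t0 : 0 <= A / (A + B) by rewrite divr_ge0 ?ltW.
have t1 : A / (A + B) <= 1 by rewrite ler_pdivrMr// mul1r lerDl ltW.
have xA0 : 0 <= x / A by rewrite divr_ge0// ltW.
have yB0 : 0 <= y / B by rewrite divr_ge0// ltW.
set t := A / (A + B) in t0 t1 *.
have : (t * (x / A) + (1 - t) * (y / B)) `^ p
    <= t * (x / A) `^ p + (1 - t) * (y / B) `^ p.
  apply: (convex_powR p1 (Itv01 t0 t1)); rewrite !inE /= in_itv /= andbT.
    exact: xA0.
  exact: yB0.
rewrite /t.
have -> : 1 - A / (A + B) = B / (A + B) by field; rewrite gt_eqF.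
have -> : A / (A + B) * (x / A) + B / (A + B) * (y / B) = (x + y) / (A + B).
  by field; rewrite !gt_eqF.
have powR_div (u v : R) : 0 <= u -> 0 < v -> (u / v) `^ p = u `^ p / v `^ p.
  move=> u0 v0; rewrite powRM// ?invr_ge0 ?ltW//.
  (* The inverse of [v] is its power of exponent -1, and iterated powers commute. *)
  by rewrite -powR_inv1 ?ltW// powRAC powR_inv1// powR_ge0.
rewrite !powR_div ?addr_ge0// => /(ler_wpM2l (powR_ge0 (A + B) p)).
by rewrite mulrCA mulfV ?mulr1// gt_eqF// powR_gt0.
Qed.

(** Settles the degenerate case, in which a norm vanishes and cannot be divided by: a sum of
    nonnegative terms is zero only if each term is. *)
Lemma sum_powR_eq0 {R : realType} {I : finType} {p q : R} {x : I -> R} :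
  (\sum_i x i `^ p) `^ q = 0 -> forall i, x i = 0.
Proof.
move=> /powR_eq0_eq0 x0 i; apply: (@powR_eq0_eq0 _ _ p).
by apply: (psumr_eq0P _ x0) => // j _; exact: powR_ge0.
Qed.

Lemma minkowski_sum2 {R : realType} {I : finType} {p : R} {x y : I -> R} :
  1 <= p -> (forall i, 0 <= x i) -> (forall i, 0 <= y i) ->
  (\sum_i (x i + y i) `^ p) `^ p^-1
    <= (\sum_i x i `^ p) `^ p^-1 + (\sum_i y i `^ p) `^ p^-1.
Proof.
move=> p1 x0 y0.
have p0 : 0 < p by exact: lt_le_trans p1.
set A := (\sum_i x i `^ p) `^ p^-1; set B := (\sum_i y i `^ p) `^ p^-1.
(* If one norm is zero, its vector is zero and both sides are equal. *)
have [A0|A0] := eqVneq A 0.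
  under eq_bigr do rewrite (sum_powR_eq0 A0) add0r.
  by rewrite A0 add0r.
have [B0|B0] := eqVneq B 0.
  under eq_bigr do rewrite (sum_powR_eq0 B0) addr0.
  by rewrite B0 addr0.
have {}A0 : 0 < A by rewrite lt_def A0 powR_ge0.
have {}B0 : 0 < B by rewrite lt_def B0 powR_ge0.
have sum_ge0 (z : I -> R) : 0 <= \sum_i z i `^ p.
  by apply: sumr_ge0 => i _; exact: powR_ge0.
have rootK (z : R) : 0 <= z -> (z `^ p^-1) `^ p = z.
  by move=> z0; rewrite -powRrM mulVf ?gt_eqF// powRr1.
have xA : \sum_i x i `^ p = A `^ p by rewrite rootK.
have yB : \sum_i y i `^ p = B `^ p by rewrite rootK.
clearbody A B.
have AB0 : 0 < A + B by exact: addr_gt0.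
(* The power [p^-1] is monotone on nonnegative reals, so both sides may be compared before taking
   roots. *)
suff le_pow : \sum_i (x i + y i) `^ p <= (A + B) `^ p.
  have -> : A + B = ((A + B) `^ p) `^ p^-1.
    by rewrite powRAC rootK// ltW.
  by apply: ge0_ler_powR; rewrite ?nnegrE ?invr_ge0 ?sum_ge0 ?powR_ge0// ltW.
apply: le_trans (ler_sum _ (fun i _ => powR_addr_le p1 A0 B0 (x0 i) (y0 i))) _.
(* By [xA] and [yB] the normalised powers sum to 1 for each vector, which leaves the two weights,
   whose sum is 1. *)
rewrite -mulr_sumr big_split/= -!mulr_sumr -!mulr_suml xA yB.
rewrite !mulfV ?gt_eqF ?powR_gt0// !mulr1 -mulrDl mulfV ?mulr1//.
by rewrite gt_eqF.
Qed.

Theorem mainTheorem2 (R : realType) (n m : nat) (hn : (1 <= n)%N)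
    (hm : (1 <= m)%N) (p : R) (hp : 1 <= p) (a : 'I_m -> 'I_n -> R)
    (ha : forall (k : 'I_m) (i : 'I_n), 0 <= a k i) :
  (\sum_(i < n) (\sum_(k < m) a k i) `^ p) `^ (1 / p)
    <= \sum_(k < m) (\sum_(i < n) (a k i) `^ p) `^ (1 / p).
Proof.
have p_neq0 : p != 0 by rewrite gt_eqF// (lt_le_trans _ hp).
rewrite div1r; elim: (index_enum 'I_m) => [|k s IHs].
  under eq_bigr do rewrite big_nil powR0//.
  by rewrite big_nil big1_eq powR0// invr_eq0.
rewrite big_cons; under [in leLHS]eq_bigr do rewrite big_cons.
(* The two vectors are [a k] and the sum of the vectors indexed by [s]. *)
apply: le_trans (minkowski_sum2 hp (ha k) _) _; last by rewrite lerD2l.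
by move=> i; exact: sumr_ge0.
Qed.
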